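(* The spectrum of nim numbers of sums of avoidance games on vertex geometries of trees is $\{0,1,2,3\}$; that is, the set of all values $\mathrm{nim}(G_1+G_2)$, where each $G_i=\mathrm{DNG}(S_i,W_i)$ is an avoidance game on the vertex geometry $(S_i,\mathcal{K}_i)$ of a tree with $W_i\subseteq S_i$ nonempty, equals $\{0,1,2,3\}$.
   Context: The vertex geometry of a finite tree $T$ with vertex set $S$ is the convex geometry $(S,\mathcal{K})$ where $\mathcal{K}$ consists of the vertex sets of connected subgraphs of $T$ (the empty set included). The convex closure operator is $\tau(A)=\bigcap\{K\in\mathcal{K}\mid A\subseteq K\}$ for $A\subseteq S$. Avoidance game $\mathrm{DNG}(S,W)$, for nonempty $W\subseteq S$: two players alternately choose previously unchosen points of $S$, starting from the empty set of chosen points; a player may choose a point only if, with $P$ the set of all jointly chosen points after the move, $W\not\subseteq\tau(P)$. The last player able to move wins. The nim number of a position $P$ of an impartial game is defined recursively by $\mathrm{nim}(P)=\mathrm{mex}\{\mathrm{nim}(Q)\mid Q\in\mathrm{Opt}(P)\}$, where $\mathrm{Opt}(P)$ is the set of positions reachable from $P$ in one legal move and $\mathrm{mex}(A)$ is the smallest nonnegative integer not in $A$; the nim number of a game is that of its starting position. The sum $P+R$ of two games has options $\mathrm{Opt}(P+R)=\{Q+R\mid Q\in\mathrm{Opt}(P)\}\cup\{P+U\mid U\in\mathrm{Opt}(R)\}$. *)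

(* Defs.v *)
From mathcomp Require Import all_boot.
From Stdlib Require Import Wellfounded Relation_Operators PeanoNat.

Set Implicit Arguments.
Unset Strict Implicit.
Unset Printing Implicit Defensive.

(* Finite simple graphs are symmetric irreflexive relations on a finType. *)

Definition acyclic (S : finType) (e : rel S) : Prop :=
  forall c : seq S, ucycle e c -> size c <= 2.

Definition is_tree (S : finType) (e : rel S) : Prop :=
  [/\ symmetric e, irreflexive e, 0 < #|S|,
      forall x y : S, connect e x y & acyclic e].

(* (K, F) is a subgraph of e; each edge is represented in F by both of its
   orientations. *)
Definition subgraph (S : finType) (e : rel S) (K : {set S})
    (F : {set S * S}) : bool :=
  [forall x, forall y, ((x, y) \in F) ==>
     [&& e x y, x \in K, y \in K & (y, x) \in F]].

Definition connected_graph (S : finType) (K : {set S})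
    (F : {set S * S}) : bool :=
  [forall x in K, forall y in K, connect (fun a b => (a, b) \in F) x y].

(* The empty set is a member, as the vertex set of the empty subgraph. *)
Definition vertex_geometry (S : finType) (e : rel S) : {set {set S}} :=
  [set K : {set S} |
     [exists F : {set S * S}, subgraph e K F && connected_graph K F]].

Definition tau (S : finType) (K : {set {set S}}) (A : {set S}) : {set S} :=
  \bigcap_(C in K | A \subset C) C.

Record game := Game {
  pos : finType;
  opt : pos -> {set pos};
  start : pos;
  opt_wf : well_founded (fun q p : pos => q \in opt p)
}.

Lemma ex_notin (s : seq nat) : exists n, n \notin s.
Proof.
exists (foldr maxn 0 s).+1; apply/negP.
suff H n : n \in s -> n <= foldr maxn 0 s by move/H; rewrite ltnn.
elim: s => //= m s IHs; rewrite inE => /orP[/eqP-> | /IHs le_n].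
  exact: leq_maxl.
exact: leq_trans le_n (leq_maxr _ _).
Qed.

Definition mex (s : seq nat) : nat := ex_minn (ex_notin s).

Definition nim_pos (G : game) : pos G -> nat :=
  Fix (@opt_wf G) (fun _ => nat)
    (fun p rec =>
       mex (codom (fun q : {q : pos G | q \in opt p} =>
                     rec (val q) (valP q)))).

Lemma codom_sub_enum (U : finType) (A : {set U}) (f : U -> nat) :
  codom (fun q : {q : U | q \in A} => f (val q)) =i [seq f q | q in A].
Proof.
move=> n; apply/codomP/imageP => [[[q Aq] ->] | [q Aq ->]].
  by exists q.
by exists (exist _ q Aq).
Qed.

Lemma eq_mex (s t : seq nat) : s =i t -> mex s = mex t.
Proof. by move=> eq_st; apply: eq_ex_minn => n; rewrite eq_st. Qed.

Lemma nim_posE (G : game) (p : pos G) :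
  nim_pos p = mex [seq nim_pos q | q in opt p].
Proof.
rewrite /nim_pos Fix_eq => [|x f g eq_fg]; last first.
  by congr mex; apply: eq_codom => q; apply: eq_fg.
exact/eq_mex/codom_sub_enum.
Qed.

Definition nim (G : game) : nat := nim_pos (start G).

Definition sum_opt (G H : game) (p : pos G * pos H) : {set pos G * pos H} :=
  [set (q, p.2) | q in opt p.1] :|: [set (p.1, u) | u in opt p.2].

Lemma sum_opt_wf (G H : game) :
  well_founded (fun q p : pos G * pos H => q \in sum_opt p).
Proof.
apply: (wf_incl _ _ (symprod _ _ (fun q p : pos G => q \in opt p)
                                  (fun q p : pos H => q \in opt p))).
  move=> q [p r]; rewrite inE => /orP[] /imsetP[x Hx ->] /=.
    exact: left_sym.
  exact: right_sym.
by apply: wf_symprod; apply: opt_wf.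
Qed.

Definition sum_game (G H : game) : game :=
  @Game (pos G * pos H)%type (@sum_opt G H) (start G, start H)
    (@sum_opt_wf G H).

(* A position is the set P of jointly chosen points. *)
Definition dng_opt (S : finType) (K : {set {set S}}) (W P : {set S}) :
    {set {set S}} :=
  [set x |: P | x in ~: P & ~~ (W \subset tau K (x |: P))].

Lemma dng_opt_wf (S : finType) (K : {set {set S}}) (W : {set S}) :
  well_founded (fun Q P : {set S} => Q \in dng_opt K W P).
Proof.
apply: (wf_incl _ _ (fun Q P : {set S} => (#|~: Q| < #|~: P|)%coq_nat)).
  move=> Q P /imsetP[x]; rewrite !inE => /andP[Px _] ->; apply/ltP.
  apply: proper_card; rewrite properE !setCS subsetUr /=.
  by rewrite subUset sub1set (negbTE Px).
exact: (wf_inverse_image _ _ _ (fun P : {set S} => #|~: P|) Nat.lt_wf_0).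
Qed.

Definition DNG (S : finType) (K : {set {set S}}) (W : {set S}) : game :=
  @Game {set S} (dng_opt K W) set0 (@dng_opt_wf S K W).

(* Main.v *)
Require Import Defs.
From mathcomp Require Import all_boot zify.
From Stdlib Require Import PeanoNat.

(** Nim numbers of sums are exclusive ors of the nim numbers of the summands
    ([nim_pos_sum]), and {0, 1, 2, 3} is closed under exclusive or. So it suffices
    that an avoidance game on a tree has a nim number below 4, and that all four
    values occur together with a second game of value 0.

    The bound depends on how the maximal legal sets sit in the tree. They are
    convex, and unions of convex sets that meet are convex. If [W] is one point,
    distinct maximal legal sets are disjoint; after the first move the rest is
    forced, so the start has options of value 0 and 1 only ([nim_DNG1]). If [W]
    has at least two points, any two distinct maximal legal sets cover the tree
    ([max_legal_cover]), so their complements are pairwise disjoint blocks, and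
    the game becomes: choose points, but never so that every block is hit. (In
    the tree these blocks are the branches behind the extreme points of [W].)

    This block game is solved exactly ([nim_pos_blocks]). If [q] is the parity of
    the number of unchosen points and [a], [b] count the missed blocks of odd and
    of even size, the value is [~~ q] when [b < a], [q] when [a < b], and 2 plus
    the parity of [q + a] when [a = b].

    The block game also evaluates the examples: on the path 0, ..., n - 1 with
    [W = {0, j}] the blocks are {0} and {j, ..., n - 1}, and the pairs (n, j) =
    (3, 2), (2, 1), (3, 1), (4, 2) give the values 0, 1, 2, 3. *)

Set Implicit Arguments.
Unset Strict Implicit.
Unset Printing Implicit Defensive.

(** * Nim numbers and sums of games *)

Lemma mexP (s : seq nat) (n : nat) :
  n \notin s -> (forall m, m < n -> m \in s) -> mex s = n.
Proof.
move=> s'n lt_s; rewrite /mex; case: ex_minnP => k s'k min_k.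
apply/eqP; rewrite eqn_leq min_k // leqNgt.
by apply: contraNN s'k => /lt_s.
Qed.

(** Values are recognised without computing any mex: a function that no move
    preserves, and that can always be lowered to any smaller value, is the nim
    number. The invariant [I] confines the check to the positions that play can
    reach. *)
Lemma nim_pos_eq (G : game) (I : pos G -> Prop) (f : pos G -> nat) :
    (forall p q, I p -> q \in opt p -> I q) ->
    (forall p q, I p -> q \in opt p -> f q != f p) ->
    (forall p m, I p -> m < f p -> exists2 q, q \in opt p & f q = m) ->
  forall p, I p -> nim_pos p = f p.
Proof.
move=> optI f_neq f_lt p; elim/(well_founded_ind (@opt_wf G)): p => p IHp Ip.
have IHf q : q \in opt p -> nim_pos q = f q by move=> pq; apply/IHp/optI/pq.
rewrite nim_posE; apply: mexP => [|m /f_lt-/(_ Ip)[q pq <-]].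
  by apply/imageP=> -[q pq]; rewrite IHf // => /esym/eqP; apply/negP/f_neq.
by apply/imageP; exists q => //; rewrite IHf.
Qed.

Lemma nim_pos_opt (G : game) (p q : pos G) :
  q \in opt p -> nim_pos q != nim_pos p.
Proof.
move=> pq; rewrite [nim_pos p]nim_posE /mex; case: ex_minnP => k + _.
by apply: contraNneq => <-; apply: image_f.
Qed.

Lemma nim_pos_lt (G : game) (p : pos G) (m : nat) :
  m < nim_pos p -> exists2 q, q \in opt p & nim_pos q = m.
Proof.
rewrite nim_posE /mex; case: ex_minnP => k _ min_k lt_mk.
have /imageP[q pq ->]: m \in [seq nim_pos q | q in opt p].
  by apply: contraLR lt_mk => /min_k; rewrite -leqNgt.
by exists q.
Qed.

Lemma lxor_bit (a b : bool) (x y : nat) :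
  Nat.lxor (a + x.*2) (b + y.*2) = (a (+) b) + (Nat.lxor x y).*2.
Proof.
have bitE (c : bool) z : c + z.*2 = (2 * z + Nat.b2n c)%coq_nat.
  by rewrite addnC -mul2n; case: c.
rewrite !bitE; apply: Nat.bits_inj => -[|i]; rewrite Nat.lxor_spec.
  by rewrite !Nat.testbit_0_r; case: a; case: b.
by rewrite !Nat.testbit_succ_r Nat.lxor_spec.
Qed.

(** The combinatorial core of the theory of sums: anything below the nim sum
    [a (+) b] arises by lowering one of the two summands. By induction on the
    binary length: either the upper halves already allow it, or they agree and
    the last bit of [m] is 0 while the last bits of [a] and [b] differ, so
    clearing the one that is set is enough. *)
Lemma lxor_lt (a b m : nat) :
    m < Nat.lxor a b ->
  (exists2 c, c < a & Nat.lxor c b = m) \/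
  (exists2 c, c < b & Nat.lxor a c = m).
Proof.
elim: {a}a.+1 {-2}a (ltnSn a) b m => // n IHn a le_an b m.
rewrite -(odd_double_half a) -(odd_double_half b) -(odd_double_half m).
have [->|a_gt0] := posnP a.
  rewrite lxor_bit /= !add0n Nat.lxor_0_l; move=> lt_mb; right.
  exists (odd m + m./2.*2) => //; rewrite !odd_double_half.
  exact: Nat.lxor_0_l.
rewrite lxor_bit; set x := a./2; set y := b./2; set z := m./2 => lt_m.
have [lt_z | le_z] := ltnP z (Nat.lxor x y).
  have lt_xn: x < n by rewrite /x; lia.
  have [[c lt_c Ec]|[c lt_c Ec]] := IHn x lt_xn y z lt_z.
    left; exists (odd m (+) odd b + c.*2); first by lia.
    by rewrite lxor_bit Ec addbK.
  right; exists (odd m (+) odd a + c.*2); first by lia.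
  by rewrite lxor_bit Ec addbC addbK.
(* The upper halves agree, so the deficit of m lies in the last bit. *)
have Ez : z = Nat.lxor x y by lia.
have [ma ab] : ~~ odd m /\ odd a (+) odd b by lia.
case oa: (odd a) ab => /= ob.
  left; exists (odd b + x.*2); first by lia.
  by rewrite lxor_bit addbb -Ez (negPf ma).
right; exists (odd a + y.*2); first by lia.
by rewrite -[X in Nat.lxor X]/(false + x.*2) oa lxor_bit -Ez (negPf ma).
Qed.

(** Sprague-Grundy: exclusive or with a fixed number is injective, so a move in
    one summand changes the nim sum, and [lxor_lt] provides the lowering
    moves. *)
Theorem nim_pos_sum (G H : game) (p : pos G) (u : pos H) :
  nim_pos ((p, u) : pos (sum_game G H)) = Nat.lxor (nim_pos p) (nim_pos u).
Proof.
pose f (r : pos (sum_game G H)) := Nat.lxor (nim_pos r.1) (nim_pos r.2).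
apply: (@nim_pos_eq _ (fun=> True) f) => // {p u} [[p u] q|[p u] m] _.
  rewrite inE => /orP[] /imsetP[v pv ->] /=.
    apply: contra (nim_pos_opt pv) => /eqP eq_f; apply/eqP.
    move/(congr1 (Nat.lxor^~ (nim_pos u))): eq_f.
    by rewrite /f /= !Nat.lxor_assoc Nat.lxor_nilpotent !Nat.lxor_0_r.
  apply: contra (nim_pos_opt pv) => /eqP eq_f; apply/eqP.
  move/(congr1 (Nat.lxor (nim_pos p))): eq_f.
  by rewrite /f /= -!Nat.lxor_assoc Nat.lxor_nilpotent !Nat.lxor_0_l.
case/lxor_lt=> -[c /nim_pos_lt[v pv <-] <-].
  exists (v, u) => //; rewrite inE; apply/orP; left.
  by apply/imsetP; exists v.
exists (p, v) => //; rewrite inE; apply/orP; right.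
by apply/imsetP; exists v.
Qed.

(** * Avoiding to hit every block of a disjoint family *)

(** The value of a position that misses [a] blocks of odd size and [b] blocks of
    even size; [q] is the parity of the number of unchosen points. *)
Definition block_value (q : bool) (a b : nat) : nat :=
  if a == b then 2 + (q (+) odd a) else q (+) (b < a).

Lemma block_value_lt4 q a b : block_value q a b < 4.
Proof. by rewrite /block_value; case: ifP; lia. Qed.

Section BlockGame.

Variables (S : finType) (K : {set {set S}}) (W : {set S}) (T : {set {set S}}).
Hypotheses (trivT : trivIset T) (T'0 : set0 \notin T).
Hypothesis legalE : forall P : {set S},
  ~~ (W \subset tau K P) = [exists D in T, [disjoint D & P]].

Definition unhit (P : {set S}) : {set {set S}} :=
  [set D in T | [disjoint D & P]].

Definition odd_blocks (U : {set {set S}}) : nat := \sum_(D in U) odd #|D|.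
Definition even_blocks (U : {set {set S}}) : nat := \sum_(D in U) ~~ odd #|D|.

(** The number of points plus the number of chosen ones has the parity of the
    number of unchosen ones. *)
Definition position_value (P : {set S}) : nat :=
  block_value (odd (#|S| + #|P|))
    (odd_blocks (unhit P)) (even_blocks (unhit P)).

Lemma unhit_trivIset P : trivIset (unhit P).
Proof. by apply: trivIsetS trivT; apply/subsetP=> D /setIdP[]. Qed.

Lemma block_in (U : {set {set S}}) D : D \in U ->
  odd_blocks U = odd #|D| + odd_blocks (U :\ D) /\
  even_blocks U = ~~ odd #|D| + even_blocks (U :\ D).
Proof. by move=> UD; rewrite /odd_blocks /even_blocks !(big_setD1 D UD). Qed.

Lemma odd_cover U : trivIset U -> odd #|cover U| = odd (odd_blocks U).
Proof.
move=> /eqP <-; rewrite /odd_blocks.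
by elim/big_rec2: _ => // D k l _; rewrite !oddD oddb => ->.
Qed.

Lemma card_blocks U : odd_blocks U + even_blocks U = #|U|.
Proof.
rewrite -big_split -sum1_card; apply: eq_bigr => D _.
by case: (odd _).
Qed.

Lemma optE (P Q : {set S}) :
  reflect (exists x, [/\ x \notin P, Q = x |: P & unhit Q != set0])
          (Q \in dng_opt K W P).
Proof.
have E R : (unhit R != set0) = ~~ (W \subset tau K R).
  rewrite legalE; apply/set0Pn/existsP.
    by move=> [D /setIdP[TD DR]]; exists D; rewrite TD.
  by move=> [D /andP[TD DR]]; exists D; rewrite inE TD.
apply: (iffP imsetP) => [[x + ->] | [x [Px -> leg]]].
  by rewrite !inE => /andP[Px leg]; exists x; rewrite E.
by exists x => //; rewrite !inE Px -E.
Qed.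

Lemma unhitU1 x (P : {set S}) :
  unhit (x |: P) = [set D in unhit P | x \notin D].
Proof.
apply/setP=> D; rewrite !inE -!setI_eq0 setIUr setU_eq0 setI_eq0 disjoint_sym.
by rewrite disjoints1 [_ && (D :&: P == _)]andbC andbA.
Qed.

Lemma unhit_stay x (P : {set S}) :
  x \notin cover (unhit P) -> unhit (x |: P) = unhit P.
Proof.
move=> U'x; rewrite unhitU1; apply/setP=> D; rewrite inE andb_idr // => UD.
by apply: contraNN U'x => Dx; apply/bigcupP; exists D.
Qed.

Lemma unhit_drop x (P D : {set S}) :
  D \in unhit P -> x \in D -> unhit (x |: P) = unhit P :\ D.
Proof.
move=> UD Dx; rewrite unhitU1; apply/setP=> E; rewrite inE in_setD1 andbC.
have [UE|] := boolP (E \in unhit P); rewrite !(andbT, andbF) //.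
apply/idP/idP; first by apply: contraNneq => ->.
move/(trivIsetP (unhit_trivIset P) _ _ UE UD).
by rewrite disjoint_sym => /disjointFr->.
Qed.

Lemma opt_cases (P Q : {set S}) : Q \in dng_opt K W P ->
  #|Q| = #|P|.+1 /\ (unhit Q = unhit P \/
                     exists2 D, D \in unhit P & unhit Q = unhit P :\ D).
Proof.
move=> /optE[x [Px -> _]]; rewrite cardsU1 Px; split=> //.
have [/bigcupP[D UD Dx] | U'x] := boolP (x \in cover (unhit P)).
  by right; exists D; rewrite ?(unhit_drop UD Dx).
by left; rewrite unhit_stay.
Qed.

(** A point of a missed block is always available; it may be chosen as long as
    another missed block remains. *)
Lemma drop_opt (P D : {set S}) : D \in unhit P -> 1 < #|unhit P| ->
  exists Q, [/\ Q \in dng_opt K W P, #|Q| = #|P|.+1 & unhit Q = unhit P :\ D].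
Proof.
move=> UD gt1; have /setIdP[TD DP] := UD.
have [x Dx]: exists x, x \in D by apply/set0Pn/(contraNneq _ T'0) => <-.
have Px: x \notin P by rewrite (disjointFr DP Dx).
exists (x |: P); rewrite cardsU1 Px (unhit_drop UD Dx); split=> //.
apply/optE; exists x; split=> //; rewrite (unhit_drop UD Dx) -card_gt0.
by move: gt1; rewrite (cardsD1 D (unhit P)) UD.
Qed.

(** A waiting move, which leaves the missed blocks alone, needs an unchosen point
    outside all of them. When the parity of the unchosen points differs from the
    parity of the points in the missed blocks, counting shows that there is
    one. *)
Lemma stay_opt (P : {set S}) : unhit P != set0 ->
    odd (#|S| + #|P|) != odd (odd_blocks (unhit P)) ->
  exists Q, [/\ Q \in dng_opt K W P, #|Q| = #|P|.+1 & unhit Q = unhit P].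
Proof.
move=> U_n0 par.
have dPU: [disjoint P & cover (unhit P)].
  by apply: bigcup_disjoint => D /setIdP[_]; rewrite disjoint_sym.
have [x]: exists x, x \in ~: (P :|: cover (unhit P)).
  apply/set0Pn; apply: contraNneq par => C0.
  have := cardsC (P :|: cover (unhit P)); rewrite C0 cards0 addn0 cardsU.
  rewrite (disjoint_setI0 dPU) cards0 subn0 => <-.
  by rewrite addnAC oddD addnn odd_double odd_cover ?unhit_trivIset.
rewrite !inE negb_or => /andP[Px U'x]; exists (x |: P).
rewrite cardsU1 Px unhit_stay //; split=> //.
by apply/optE; exists x; rewrite unhit_stay.
Qed.

(** Every move flips [q] and either keeps the pair [(a, b)] or lowers one entry by
    one, so it changes the value: the value tracks [q] as long as the comparison
    of [a] and [b] stays the same, and lies in {0, 1} or {2, 3} according to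
    whether [a] and [b] differ. Conversely, when [a = b], hitting an odd or an
    even block yields the values 0 and 1, and a waiting move takes 3 to 2. When
    [a <> b] and the value is 1, the move to 0 hits a block of the minority kind;
    if there is none, one waits or hits a majority block, as parity permits. *)
Theorem nim_pos_blocks (P : pos (DNG K W)) :
  unhit P != set0 -> nim_pos P = position_value P.
Proof.
move: P; apply: (@nim_pos_eq (DNG K W)) => [P Q _ | P Q U_n0 | P m U_n0].
- by case/optE=> x [_ -> U_n0]; exact: U_n0.
- move=> PQ; have /optE[_ [_ _ Q_n0]] := PQ.
  case/opt_cases: PQ; rewrite /position_value => -> [->|[D UD UQ]].
    by rewrite addnS /block_value /=; case: ifP; lia.
  move: Q_n0; rewrite UQ -card_gt0 -card_blocks.
  have [-> ->] := block_in UD.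
  by rewrite addnS /block_value /=; case: odd; do !case: ifP; lia.
have card_n0: 0 < #|unhit P| by rewrite card_gt0.
set a := odd_blocks (unhit P); set b := even_blocks (unhit P).
have drop c : (exists2 D, D \in unhit P & odd #|D| = c) -> 1 < a + b ->
    exists2 Q, Q \in dng_opt K W P &
      position_value Q =
      block_value (~~ odd (#|S| + #|P|)) (a - c) (b - ~~ c).
  move=> [D UD <-]; rewrite card_blocks => /(drop_opt UD)[Q [PQ cQ UQ]].
  exists Q => //; rewrite /position_value cQ UQ addnS /= /a /b.
  by have [-> ->] := block_in UD; rewrite !addKn.
have drop_odd : 0 < a -> exists2 D, D \in unhit P & odd #|D| = true.
  rewrite lt0n sum_nat_eq0 negb_forall => /existsP[D].
  rewrite negb_imply => /andP[UD].
  by rewrite eqb0 negbK; exists D.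
have drop_even : 0 < b -> exists2 D, D \in unhit P & odd #|D| = false.
  rewrite lt0n sum_nat_eq0 negb_forall => /existsP[D].
  rewrite negb_imply => /andP[UD].
  by rewrite eqb0 negbK => /negbTE; exists D.
have stay : odd (#|S| + #|P|) != odd a ->
    exists2 Q, Q \in dng_opt K W P &
      position_value Q = block_value (~~ odd (#|S| + #|P|)) a b.
  move=> /(stay_opt U_n0)[Q [PQ cQ UQ]]; exists Q => //.
  by rewrite /position_value cQ UQ addnS.
rewrite -card_blocks -/a -/b in card_n0.
rewrite {1}/position_value -/a -/b; set q := odd _ in drop stay *.
have reach v : (exists2 Q, Q \in dng_opt K W P & position_value Q = v) ->
    v = m -> exists2 Q, Q \in dng_opt K W P & position_value Q = m.
  by move=> optv <-.
move: drop stay reach; clearbody a b q => drop stay reach.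
rewrite {1}/block_value; case: eqP => [eq_ab | neq_ab] lt_m.
  (* Only the value 3 leaves room for m = 2, and then waiting is possible. *)
  have [m2 | m_lt2] := leqP 2 m.
    apply: (reach _ (stay _)); rewrite /block_value ?eq_ab ?eqxx.
      by move: lt_m; case: (q); lia.
    by move: lt_m; case: (q); lia.
  have [Em | Em] : m = ~~ q \/ m = q by case: (q); lia.
    apply: (reach _ (drop true (drop_odd _) _)); try lia.
    by rewrite /block_value; case: (q) Em => Em; do !case: ifP; lia.
  apply: (reach _ (drop false (drop_even _) _)); try lia.
  by rewrite /block_value; case: (q) Em => Em; do !case: ifP; lia.
(* From here on the value is 1 and m is 0. *)
have [lt_ab | le_ba] := ltnP a b.
  have qT : q by move: lt_m; case: (q); lia.
  have [a0 | a_gt0] := posnP a.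
    apply: (reach _ (stay _)); rewrite /block_value qT a0 //=.
    by case: ifP; lia.
  apply: (reach _ (drop true (drop_odd _) _)); try lia.
  by rewrite /block_value qT /=; do !case: ifP; lia.
have qF : q = false by move: lt_m; case: (q); lia.
have [b0 | b_gt0] := posnP b.
  case odd_a: (odd a).
    apply: (reach _ (stay _)); rewrite /block_value qF ?odd_a ?b0 //=.
    by case: ifP; lia.
  apply: (reach _ (drop true (drop_odd _) _)); try lia.
  by rewrite /block_value qF b0 /=; do !case: ifP; lia.
apply: (reach _ (drop false (drop_even _) _)); try lia.
by rewrite /block_value qF /=; do !case: ifP; lia.
Qed.

End BlockGame.

(** * Maximal legal sets in the geometry of a connected graph *)

Section MaximalLegal.

Variables (S : finType) (K : {set {set S}}) (W : {set S}).

Lemma legalP (P : {set S}) :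
  reflect (exists C, [/\ C \in K, P \subset C & ~~ (W \subset C)])
          (~~ (W \subset tau K P)).
Proof.
apply: (iffP idP) => [W'P | [C [KC PC]]].
  have [C /and3P[]|noC] :=
    pickP (fun C => [&& C \in K, P \subset C & ~~ (W \subset C)]).
    by exists C.
  case/negP: W'P; apply/bigcapsP=> C /andP[KC PC].
  by have:= noC C; rewrite KC PC => /negbFE.
by apply: contraNN => /subset_trans; apply; apply: bigcap_inf; rewrite KC.
Qed.

Definition max_legal : {set {set S}} :=
  [set C | maxset (fun P => ~~ (W \subset tau K P)) C].

(** A maximal legal set is convex, because some convex set that contains it is
    legal too. *)
Lemma max_legalP (C : {set S}) : C \in max_legal ->
  [/\ C \in K, ~~ (W \subset C) &
      forall D, D \in K -> C \subset D -> D != C -> W \subset D].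
Proof.
rewrite inE => /maxsetP[/legalP[D [KD CD W'D]] maxC].
have max D1 : D1 \in K -> C \subset D1 -> D1 != C -> W \subset D1.
  move=> KD1 CD1; apply: contraNT => W'D1; apply/eqP/maxC => //.
  by apply/legalP; exists D1.
have /eqP DC : D == C by apply: contraNT W'D; apply: max.
by split=> //; rewrite -DC.
Qed.

Lemma legal_max (P : {set S}) :
  ~~ (W \subset tau K P) = [exists C in max_legal, P \subset C].
Proof.
apply/idP/exists_inP => [legP | [C /max_legalP[KC W'C _]]].
  have [C maxC PC] :=
    maxset_exists (P := fun Q : {set S} => ~~ (W \subset tau K Q)) legP.
  by exists C; rewrite ?inE.
by move=> PC; apply/legalP; exists C.
Qed.

End MaximalLegal.

Section Geometry.

Variables (S : finType) (e : rel S).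

Lemma geometryP (C : {set S}) :
  reflect (exists F : {set S * S},
      [/\ forall x y, (x, y) \in F ->
            [/\ e x y, x \in C, y \in C & (y, x) \in F]
        & {in C &, forall x y, connect (fun a b => (a, b) \in F) x y}])
    (C \in vertex_geometry e).
Proof.
rewrite inE; apply: (iffP existsP) => [[F /andP[sF cF]] | [F [sF cF]]].
  exists F; split=> [x y Fxy | x y Cx Cy].
    by have /forallP/(_ x)/forallP/(_ y)/implyP/(_ Fxy)/and4P := sF.
  by have /forall_inP/(_ x Cx)/forall_inP/(_ y Cy) := cF.
exists F; apply/andP; split.
  by apply/forallP=> x; apply/forallP=> y; apply/implyP=> /sF/and4P.
by apply/forall_inP=> x Cx; apply/forall_inP=> y Cy; apply: cF.
Qed.

(** Two connected subgraphs with a common vertex [z] have a connected union: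
    paths go through [z]. *)
Lemma geometryU (C D : {set S}) :
    C \in vertex_geometry e -> D \in vertex_geometry e ->
  ~~ [disjoint C & D] -> C :|: D \in vertex_geometry e.
Proof.
move=> /geometryP[F [sF cF]] /geometryP[G [sG cG]] /pred0Pn[z /andP[Cz Dz]].
apply/geometryP; exists (F :|: G); split=> [x y|].
  rewrite !inE => /orP[/sF | /sG] [-> -> -> ->]; rewrite ?orbT //.
have sub (E : {set S * S}) : E \subset F :|: G ->
    subrel (connect (fun a b => (a, b) \in E))
           (connect (fun a b => (a, b) \in F :|: G)).
  by move=> sE; apply: connect_sub => a b Eab; apply/connect1/(subsetP sE).
have /sub subF := subsetUl F G; have /sub subG := subsetUr F G.
have toz x : x \in C :|: D ->
    connect (fun a b => (a, b) \in F :|: G) x z /\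
    connect (fun a b => (a, b) \in F :|: G) z x.
  rewrite inE => /orP[Cx | Dx].
    by split; apply: subF; apply: cF.
  by split; apply: subG; apply: cG.
by move=> x y /toz[xz _] /toz[_ zy]; apply: connect_trans xz zy.
Qed.

Lemma geometry0 : set0 \in vertex_geometry e.
Proof.
by apply/geometryP; exists set0; split=> x y; rewrite !in_set0.
Qed.

Lemma geometry1 (x : S) : [set x] \in vertex_geometry e.
Proof.
apply/geometryP; exists set0; split=> [u v | u v]; first by rewrite !in_set0.
by move=> /set1P-> /set1P->; apply: connect0.
Qed.

(** [x |: C] is the union of [C] and the edge from [x] to [y], which meet in
    [y]. *)
Lemma geometryU1 (x y : S) (C : {set S}) : symmetric e ->
  C \in vertex_geometry e -> y \in C -> e x y -> x |: C \in vertex_geometry e.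
Proof.
move=> sym_e geoC Cy exy.
have -> : x |: C = [set x; y] :|: C.
  by apply/setP=> z; rewrite !inE -orbA; case: eqP => // _; case: eqP => [->|].
apply: geometryU => //; last first.
  by apply/pred0Pn; exists y; rewrite /= !inE eqxx orbT.
apply/geometryP; exists [set (x, y); (y, x)]; split=> [u v | u v].
  rewrite !inE !xpair_eqE => /orP[] /andP[/eqP-> /eqP->];
    by rewrite ?[e y x]sym_e !eqxx ?orbT.
have cxy: connect (fun a b => (a, b) \in [set (x, y); (y, x)]) x y.
  by apply: connect1; rewrite !inE eqxx.
have cyx: connect (fun a b => (a, b) \in [set (x, y); (y, x)]) y x.
  by apply: connect1; rewrite !inE eqxx orbT.
by rewrite !inE => /orP[] /eqP-> /orP[] /eqP->; rewrite ?connect0.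
Qed.

End Geometry.

Section Values.

Variables (S : finType) (e : rel S).
Let K := vertex_geometry e.

(** The union is convex, so it would be a larger legal set. *)
Lemma max_legal_eq (W C D : {set S}) :
    C \in max_legal K W -> D \in max_legal K W ->
  ~~ [disjoint C & D] -> ~~ (W \subset C :|: D) -> C = D.
Proof.
move=> /max_legalP[KC _ maxC] /max_legalP[KD _ maxD] CD W'CD.
have KCD := geometryU KC KD CD.
have /eqP <- : C :|: D == C.
  by apply: contraNT W'CD; apply/maxC => //; apply: subsetUl.
by apply/eqP; apply: contraNT W'CD; apply/maxD => //; apply: subsetUr.
Qed.

(** With a single forbidden point the maximal legal sets are disjoint: their
    unions miss [w]. So the first move selects a maximal legal set [C], play is
    then confined to [C] and fills it, and its value is the parity of what is
    left. The starting position has options of value 0 and 1 only. *)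
Lemma nim_DNG1 (w : S) : nim (DNG K [set w]) < 4.
Proof.
have max_disj C D : C \in max_legal K [set w] -> D \in max_legal K [set w] ->
    ~~ [disjoint C & D] -> C = D.
  move=> maxC maxD CD; apply: (max_legal_eq maxC maxD CD).
  have [_ C'w _] := max_legalP maxC; have [_ D'w _] := max_legalP maxD.
  by move: C'w D'w; rewrite !sub1set inE => /negPf-> /negPf->.
have inC C : C \in max_legal K [set w] -> forall P : pos (DNG K [set w]),
    P != set0 /\ P \subset C -> nim_pos P = odd (#|C| + #|P|).
  move=> maxC.
  have optP (P Q : {set S}) : P != set0 -> P \subset C ->
      Q \in dng_opt K [set w] P -> #|Q| = #|P|.+1 /\ Q != set0 /\ Q \subset C.
    move=> P_n0 PC /imsetP[x]; rewrite !inE legal_max => /andP[Px].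
    move=> /exists_inP[D maxD xPD] ->; rewrite cardsU1 Px; split=> //.
    split; first by apply/set0Pn; exists x; rewrite !inE eqxx.
    suff -> : C = D by [].
    have [y Py] := set0Pn _ P_n0; apply: max_disj => //; apply/pred0Pn.
    exists y; rewrite /= (subsetP PC) //= (subsetP xPD) //.
    by rewrite inE Py orbT.
  apply: nim_pos_eq => [P Q [P_n0 PC] /optP-/(_ P_n0 PC)[] //||].
    move=> P Q [P_n0 PC] /optP-/(_ P_n0 PC)[-> _].
    by rewrite addnS /=; case: odd.
  move=> P m [P_n0 PC]; case par: (odd _); case: m => // _.
  have [x]: exists x, x \in C :\: P.
    apply/set0Pn; apply: contraTneq par => CP0; rewrite -(setID C P) CP0 setU0.
    by rewrite (setIidPr PC) addnn odd_double.
  rewrite inE => /andP[Px Cx]; exists (x |: P); last first.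
    by rewrite cardsU1 Px addnS /= par.
  apply/imsetP; exists x => //; rewrite !inE Px legal_max /=.
  by apply/exists_inP; exists C; rewrite // subUset sub1set Cx.
(* 2 is not the value of an option, so the mex is at most 2. *)
rewrite ltnS ltnW // ltnS /nim nim_posE /mex; case: ex_minnP => k _; apply.
apply/imageP=> -[Q /imsetP[x]]; rewrite inE legal_max setU0.
move=> /andP[_ /exists_inP[C maxC xC]] -> /=.
rewrite (inC C maxC); first by case: odd.
by split=> //; apply/set0Pn; exists x; rewrite inE.
Qed.

Hypotheses (sym_e : symmetric e) (con_e : forall x y, connect e x y).

(** A set without an outside neighbour is closed under adjacency, hence under
    connection. *)
Lemma escape (A : {set S}) : A != set0 -> A != setT ->
  exists x y, [/\ x \notin A, y \in A & e x y].
Proof.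
move=> /set0Pn[a Aa] A_nT.
have [[x y] /and3P[]|no_xy] :=
  pickP (fun p : S * S => [&& p.1 \notin A, p.2 \in A & e p.1 p.2]).
  by exists x, y.
case/eqP: A_nT; apply/setP=> b; rewrite inE -[RHS]Aa.
apply/esym/(closed_connect (e := e) (a := mem A)) => // x y exy.
apply/idP/idP => [Ax | Ay]; apply: contraT => A'.
  by have := no_xy (y, x); rewrite /= A' sym_e exy andbT => /negbT/negP[].
by have := no_xy (x, y); rewrite /= A' exy andbT => /negbT/negP[].
Qed.

Variable W : {set S}.
Hypothesis W_gt1 : 1 < #|W|.

Lemma max_legal_neq0 C : C \in max_legal K W -> C != set0.
Proof.
move=> /max_legalP[_ _ maxC]; apply/eqP=> C0.
have /card_gt0P[x _] : 0 < #|W| by apply: ltnW.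
have /subset_leq_card : W \subset [set x].
  apply: maxC; first exact: geometry1.
    by rewrite C0 sub0set.
  by rewrite C0; apply/set0Pn; exists x; rewrite inE.
by rewrite cards1 leqNgt W_gt1.
Qed.

Lemma max_legal_neqT C : C \in max_legal K W -> C != setT.
Proof.
by move=> /max_legalP[_ + _]; apply: contraNneq => ->; apply: subsetT.
Qed.

(** The only neighbour of a maximal legal set [C] is the one point of [W] that
    [C] misses: adding any neighbour keeps [C] convex, so by maximality it
    completes [W]. *)
Lemma max_legal_boundary C x y : C \in max_legal K W ->
  x \notin C -> y \in C -> e x y -> W :\: C = [set x].
Proof.
move=> /max_legalP[KC W'C maxC] Cx Cy exy.
have WxC: W \subset x |: C.
  apply: maxC; [exact: geometryU1 exy | exact: subsetUr |].
  by apply: contraNneq Cx => <-; rewrite !inE eqxx.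
apply/eqP; rewrite eqEsubset subDset setUC WxC sub1set inE Cx /=.
apply: contraNT W'C => Wx; apply/subsetP=> z Wz.
by have /setU1P[zx|//] := subsetP WxC z Wz; rewrite -zx Wz in Wx.
Qed.

(** Two maximal legal sets that miss the same point [c] of [W] meet in [W :\ c]
    and have a legal union, so they are equal. If they miss different points,
    each contains the unique neighbour of the other, and their union has no
    outside neighbour. *)
Lemma max_legal_cover C D :
  C \in max_legal K W -> D \in max_legal K W -> C != D -> C :|: D = setT.
Proof.
move=> maxC maxD neqCD.
have [c [c' [Cc Cc' ecc']]] :=
  escape (max_legal_neq0 maxC) (max_legal_neqT maxC).
have [d [d' [Dd Dd' edd']]] :=
  escape (max_legal_neq0 maxD) (max_legal_neqT maxD).
have bC := max_legal_boundary maxC; have bD := max_legal_boundary maxD.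
have WC := bC _ _ Cc Cc' ecc'; have WD := bD _ _ Dd Dd' edd'.
have in_bd E v u : W :\: E = [set v] -> (u \in W) -> u != v -> u \in E.
  move=> /setP/(_ u) + Wu /negPf neq_uv.
  by rewrite !inE Wu andbT neq_uv => /negbFE.
have [Wc Wd] : c \in W /\ d \in W.
  have := set11 c; have := set11 d.
  by rewrite -WC -WD => /setDP[-> _] /setDP[-> _].
have [eq_cd | neq_cd] := eqVneq c d.
  case/negP: neqCD; subst d.
  have [v /setD1P[vc Wv]] : exists v, v \in W :\ c.
    by apply/set0Pn; rewrite -card_gt0; move: W_gt1; rewrite (cardsD1 c) Wc.
  have CD : ~~ [disjoint C & D].
    by apply/pred0Pn; exists v; rewrite /= (in_bd _ _ _ WC) ?(in_bd _ _ _ WD).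
  apply/eqP/(max_legal_eq maxC maxD CD)/subsetPn.
  by exists c; rewrite // inE negb_or Cc.
have Dc : c \in D by apply: in_bd WD Wc neq_cd.
have Cd : d \in C by apply: in_bd WC Wd _; rewrite eq_sym.
apply/eqP; apply: contraT => CD_nT.
have CD_n0: C :|: D != set0 by apply/set0Pn; exists c; rewrite inE Dc orbT.
have [x [y [CDx CDy exy]]] := escape CD_n0 CD_nT.
move: CDx CDy; rewrite !inE negb_or => /andP[Cx Dx] /orP[Cy | Dy].
  by have := bC _ _ Cx Cy exy; rewrite WC => /set1_inj cx; rewrite -cx Dc in Dx.
by have := bD _ _ Dx Dy exy; rewrite WD => /set1_inj dx; rewrite -dx Cd in Cx.
Qed.

(** By [max_legal_cover] the complements of the maximal legal sets are disjoint
    blocks, and a position is legal exactly when it misses one of them. *)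
Lemma nim_DNG_lt4 : nim (DNG K W) < 4.
Proof.
pose T := [set ~: C | C in max_legal K W].
have trivT : trivIset T.
  apply/trivIsetP=> _ _ /imsetP[C maxC ->] /imsetP[D maxD ->] neqCD.
  rewrite -setI_eq0 -setCU (@max_legal_cover C D) ?setCT //.
  by apply: contraNneq neqCD => ->.
have T'0 : set0 \notin T.
  apply/imsetP=> -[C /max_legal_neqT/negP nT /(congr1 (@setC S))].
  by rewrite setC0 setCK => CT; apply: nT; rewrite -CT.
have legalE P : ~~ (W \subset tau K P) = [exists D in T, [disjoint D & P]].
  rewrite legal_max; apply/exists_inP/exists_inP.
    move=> [C maxC PC].
    exists (~: C); first exact: imset_f.
    by rewrite disjoint_sym disjoints_subset setCK.
  move=> [_ /imsetP[C maxC ->]].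
  by rewrite disjoint_sym disjoints_subset setCK; exists C.
rewrite /nim (nim_pos_blocks trivT T'0 legalE).
  exact: block_value_lt4.
have: ~~ (W \subset tau K set0).
  apply/legalP; exists set0; rewrite geometry0 sub0set subset0; split=> //.
  by rewrite -card_gt0 ltnW.
rewrite legalE => /exists_inP[D TD _]; apply/set0Pn; exists D.
by rewrite inE TD -setI_eq0 setI0 eqxx.
Qed.

End Values.

(** * Two-point avoidance games on paths *)

Definition path_edge (n : nat) : rel 'I_n :=
  fun x y => (x.+1 == y :> nat) || (y.+1 == x :> nat).

Definition ord_interval (n i k : nat) : {set 'I_n} :=
  [set x : 'I_n | i <= x < k].

Lemma path_edge_sym n : symmetric (@path_edge n).
Proof. by move=> x y; rewrite /path_edge orbC. Qed.

Lemma interval_geometry n i k : k <= n ->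
  ord_interval n i k \in vertex_geometry (@path_edge n).
Proof.
elim: k => [_ | k IHk lt_kn].
  suff -> : ord_interval n i 0 = set0 by apply: geometry0.
  by apply/setP=> x; rewrite !inE andbF.
have [lt_ki | le_ik] := ltnP k i.
  suff -> : ord_interval n i k.+1 = set0 by apply: geometry0.
  by apply/setP=> x; rewrite !inE; lia.
pose z := Ordinal lt_kn.
have -> : ord_interval n i k.+1 = z |: ord_interval n i k.
  apply/setP=> x; rewrite !inE -val_eqE /=; lia.
case: k => [|k] in IHk lt_kn z le_ik *.
  suff -> : ord_interval n i 0 = set0 by rewrite setU0; apply: geometry1.
  by apply/setP=> x; rewrite !inE andbF.
have [lt_ik | ge_ik] := ltnP i k.+1; last first.
  suff -> : ord_interval n i k.+1 = set0 by rewrite setU0; apply: geometry1.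
  by apply/setP=> x; rewrite !inE; lia.
have lt_k : k < n by lia.
apply: (@geometryU1 _ _ _ (Ordinal lt_k)).
- exact: path_edge_sym.
- by apply: IHk; lia.
- by rewrite inE /=; lia.
by rewrite /path_edge /= eqxx orbT.
Qed.

Lemma path_tree n : 0 < n -> is_tree (@path_edge n).
Proof.
move=> n_gt0; split.
- exact: path_edge_sym.
- by move=> x; rewrite /path_edge orbb; lia.
- by rewrite card_ord.
- have /geometryP[F [sF cF]] := interval_geometry 0 (leqnn n).
  have inF x : x \in ord_interval n 0 n by rewrite inE /=.
  move=> x y; apply: connect_sub (cF x y (inF x) (inF y)) => a b Fab.
  by apply: connect1; have [] := sF a b Fab.
(* The largest vertex x of a longer cycle would have two distinct neighbours in
   it, but both have to be x.-1. *)
move=> c /andP[cyc_c uniq_c].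
have [->|[m cm]] : c = [::] \/ exists m, m \in c.
- case: c {cyc_c uniq_c} => [|x c]; first by left.
  by right; exists x; rewrite mem_head.
- by [].
have [x cx max_x] := arg_maxnP (fun y : 'I_n => y : nat) cm.
have [i s rot_c] := rot_to cx.
rewrite -(rot_cycle i) rot_c in cyc_c.
rewrite -(rot_uniq i) rot_c in uniq_c.
rewrite -(size_rot i) rot_c.
have mem_s y : y \in s -> y <= x.
  move=> sy; have: y \in rot i c by rewrite rot_c inE sy orbT.
  by rewrite mem_rot; apply: max_x.
case: s cyc_c uniq_c mem_s {rot_c} => [|y s] //=.
case/lastP: s => [|s z] //; rewrite rcons_path last_rcons.
move=> /and3P[exy _ ezx] /and3P[_ + _] mem_s.
suff -> : y = z by rewrite mem_rcons mem_head.
have le_y : y <= x by apply: mem_s; rewrite mem_head.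
have le_z : z <= x by apply: mem_s; rewrite inE mem_rcons mem_head orbT.
apply: val_inj; move: exy ezx; rewrite /path_edge /=; lia.
Qed.

Section PathGame.

Variables (n j : nat).
Hypotheses (j_gt0 : 0 < j) (lt_jn : j < n).
Let z0 : 'I_n := Ordinal (ltn_trans j_gt0 lt_jn).
Let zj : 'I_n := Ordinal lt_jn.
Let K := vertex_geometry (@path_edge n).
Let W : {set 'I_n} := [set z0; zj].

(** An edge of a connected subgraph avoiding [zj] cannot jump over it. *)
Lemma geometry_below C :
  C \in K -> z0 \in C -> zj \notin C -> C \subset ord_interval n 0 j.
Proof.
move=> /geometryP[F [sF cF]] C0 C'j; apply/subsetP=> x Cx.
have closedF : closed (fun a b => (a, b) \in F) (mem (ord_interval n 0 j)).
  move=> a b /sF[eab Ca Cb _]; rewrite !inE /=.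
  have aj: a != zj by apply: contraNneq C'j => <-.
  have bj: b != zj by apply: contraNneq C'j => <-.
  by move: eab aj bj; rewrite /path_edge -!val_eqE /=; lia.
by have := closed_connect closedF (cF z0 x C0 Cx); rewrite !inE /= j_gt0 => <-.
Qed.

Let T : {set {set 'I_n}} := [set ord_interval n 0 1; ord_interval n j n].

(** The hull of [W] is [0, j], so the maximal legal sets are those that drop the
    left end or everything from [j] on. *)
Lemma path_legal (P : {set 'I_n}) :
  ~~ (W \subset tau K P) = [exists D in T, [disjoint D & P]].
Proof.
apply/legalP/exists_inP => [[C [KC PC W'C]] | [D TD DP]].
  have [C0 | C'0] := boolP (z0 \in C).
    have C'j : zj \notin C.
      by apply: contra W'C => Cj; rewrite subUset !sub1set C0.
    exists (ord_interval n j n); first by rewrite !inE eqxx orbT.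
    rewrite disjoint_sym disjoints_subset; apply: subset_trans PC _.
    apply: subset_trans (geometry_below KC C0 C'j) _.
    by apply/subsetP=> x; rewrite !inE; lia.
  exists (ord_interval n 0 1); first by rewrite !inE eqxx.
  rewrite disjoint_sym disjoints_subset; apply: subset_trans PC _.
  apply/subsetP=> x Cx; rewrite !inE.
  by have: x != z0 by [apply: contraNneq C'0 => <-]; rewrite -val_eqE /=; lia.
move: DP; rewrite disjoint_sym disjoints_subset => PD.
case/set2P: TD PD => -> PD.
  exists (ord_interval n 1 n); split; first exact: interval_geometry.
    apply: subset_trans PD _; apply/subsetP=> x; rewrite !inE.
    by have := ltn_ord x; lia.
  by apply/subsetPn; exists z0; rewrite !inE ?eqxx.
exists (ord_interval n 0 j); split; first by apply/interval_geometry/ltnW.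
  apply: subset_trans PD _; apply/subsetP=> x; rewrite !inE.
  by have := ltn_ord x; lia.
by apply/subsetPn; exists zj; rewrite !inE ?eqxx ?orbT //= ltnn.
Qed.

Lemma card_interval i k : k <= n -> #|ord_interval n i k| = k - i.
Proof.
elim: k => [_ | k IHk lt_kn].
  by apply: eq_card0 => x; rewrite !inE andbF.
have [lt_ki | le_ik] := ltnP k i.
  rewrite (eqP lt_ki); apply: eq_card0 => x; rewrite !inE; lia.
have -> : ord_interval n i k.+1 = Ordinal lt_kn |: ord_interval n i k.
  apply/setP=> x; rewrite !inE -val_eqE /=; lia.
by rewrite cardsU1 (IHk (ltnW lt_kn)) !inE /= ltnn andbF add1n subSn.
Qed.

Lemma nim_path : nim (DNG K W) =
  block_value (odd n) (1 + odd (n - j)) (~~ odd (n - j)).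
Proof.
have mem0 : z0 \in ord_interval n 0 1 by rewrite inE.
have memj : zj \in ord_interval n j n by rewrite inE /= leqnn.
have mem0' : z0 \notin ord_interval n j n by rewrite inE /= leqNgt j_gt0.
have neqT : ord_interval n 0 1 != ord_interval n j n.
  by apply: contraNneq mem0' => <-.
have trivT : trivIset T.
  have dT : [disjoint ord_interval n 0 1 & ord_interval n j n].
    by apply/pred0P=> x /=; rewrite !inE; lia.
  apply/trivIsetP=> A B /set2P[]-> /set2P[]->; rewrite ?eqxx //.
  by rewrite disjoint_sym.
have T'0 : set0 \notin T.
  by apply/set2P=> -[] E; move: mem0 memj; rewrite -E !in_set0.
have unhit0 : unhit T set0 = T.
  by apply/setP=> D; rewrite inE -setI_eq0 setI0 eqxx andbT.
rewrite /nim (nim_pos_blocks trivT T'0 path_legal) /=.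
  rewrite /position_value unhit0 cards0 addn0 card_ord.
  rewrite /odd_blocks /even_blocks !big_setU1 ?inE //= !big_set1.
  by rewrite !card_interval // (leq_ltn_trans _ lt_jn).
rewrite unhit0; apply/set0Pn; exists (ord_interval n j n).
by rewrite !inE eqxx orbT.
Qed.

End PathGame.

(** * The spectrum *)

Lemma lxor_lt4 (a b : nat) :
  a < 4 -> b < 4 -> Nat.lxor a b \in [:: 0; 1; 2; 3].
Proof. by case: a b => [|[|[|[|a]]]] // [|[|[|[|b]]]]. Qed.

Lemma nim_tree_lt4 (S : finType) (e : rel S) (W : {set S}) :
  is_tree e -> W != set0 -> nim (DNG (vertex_geometry e) W) < 4.
Proof.
move=> [sym_e _ _ con_e _]; rewrite -card_gt0 leq_eqVlt.
move=> /orP[W1|]; last exact: nim_DNG_lt4.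
have /cards1P[w ->] : #|W| == 1 by rewrite eq_sym.
exact: nim_DNG1.
Qed.

Lemma path_game (n j : nat) : 0 < j < n ->
  exists (S : finType) (e : rel S) (W : {set S}),
    [/\ is_tree e, W != set0 & nim (DNG (vertex_geometry e) W) =
           block_value (odd n) (1 + odd (n - j)) (~~ odd (n - j))].
Proof.
move=> /andP[j_gt0 lt_jn].
exists 'I_n, (@path_edge n).
exists [set Ordinal (ltn_trans j_gt0 lt_jn); Ordinal lt_jn]; split.
- exact: path_tree (ltn_trans j_gt0 lt_jn).
- by apply/set0Pn; exists (Ordinal lt_jn); rewrite !inE eqxx orbT.
exact: nim_path.
Qed.

Theorem theorem34 (n : nat) :
  (exists (S1 : finType) (e1 : rel S1) (W1 : {set S1})
          (S2 : finType) (e2 : rel S2) (W2 : {set S2}),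
     [/\ is_tree e1, W1 != set0, is_tree e2, W2 != set0 &
         nim (sum_game (DNG (vertex_geometry e1) W1)
                       (DNG (vertex_geometry e2) W2)) = n])
  <-> n \in [:: 0; 1; 2; 3].
Proof.
split=> [[S1 [e1 [W1 [S2 [e2 [W2 [tree1 W1_n0 tree2 W2_n0 <-]]]]]]] |].
  rewrite /nim nim_pos_sum.
  apply: lxor_lt4; first exact: nim_tree_lt4 tree1 W1_n0.
  exact: nim_tree_lt4 tree2 W2_n0.
move=> n_lt4; have [k [j [lt_jk nimG]]] : exists k j, 0 < j < k /\
    block_value (odd k) (1 + odd (k - j)) (~~ odd (k - j)) = n.
  move: n_lt4; rewrite !inE => /or4P[] /eqP->.
  - by exists 3, 2.
  - by exists 2, 1.
  - by exists 3, 1.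
  - by exists 4, 2.
have [S1 [e1 [W1 [tree1 W1_n0 nim1]]]] := path_game lt_jk.
(* The second summand is the path on 3 vertices with its ends, of value 0. *)
have [S2 [e2 [W2 [tree2 W2_n0 nim2]]]] := path_game (isT : 0 < 2 < 3).
exists S1, e1, W1, S2, e2, W2; split=> //.
by rewrite /nim nim_pos_sum [nim_pos _]nim1 [nim_pos _]nim2 nimG Nat.lxor_0_r.
Qed.
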